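(* Let $\mathcal{C}$ be a small poset-enriched category, $\Sigma$ a collection of morphisms in $\mathcal{C}$, and $F,G,H:\mathcal{C}\to\mathbf{Pos}$ enriched functors such that $GA$ is complete for every object $A$ and $Gf$ preserves all meets and joins for all $f\in\Sigma$. Let $\iota:F\to H$ be a strict transformation and let $\kappa$ be a regular cardinal. Suppose that $(G1)$ $Gf$ preserves $\kappa$-directed joins for all morphisms $f$ in $\mathcal{C}$; $(\iota1)$ for every object $A$ and every $x\in HA$, the poset $\iota_A\downarrow x=\{y\in FA\mid\iota_A(y)\le x\}$ is $\kappa$-directed; $(\iota2)$ for every $f:A\to B$ in $\Sigma$ the maps $Ff$ and $Hf$ have left adjoints $(Ff)_*:FB\to FA$ and $(Hf)_*:HB\to HA$ such that $\iota_A\circ(Ff)_*=(Hf)_*\circ\iota_B$. Then left extensions of $\Sigma$-natural colax transformations along $\iota$ are objectwise: for every $\Sigma$-natural colax transformation $\sigma:F\to G$, the left extension $\mathrm{Lan}_\iota\sigma$ satisfies $(\mathrm{Lan}_\iota\sigma)_A=\mathrm{Lan}_{\iota_A}\sigma_A$ for every object $A$ of $\mathcal{C}$.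
   Context: $\mathbf{Pos}$ is the category of posets and order-preserving maps, enriched over itself. A $\Sigma$-natural colax transformation $\sigma:F\to G$ is a family of order-preserving maps $(\sigma_A:FA\to GA)_A$ with $Gf\circ\sigma_A\le\sigma_B\circ Ff$ for all morphisms $f:A\to B$ of $\mathcal{C}$, with equality whenever $f\in\Sigma$; a strict transformation has equality for all $f$. Transformations are ordered pointwise. The left extension of $\sigma$ along $\iota:F\to H$ is the $\Sigma$-natural colax transformation $\mathrm{Lan}_\iota\sigma:H\to G$ such that $\mathrm{Lan}_\iota\sigma\circ\iota\ge\sigma$ and every $\Sigma$-natural colax $\sigma':H\to G$ with $\sigma'\circ\iota\ge\sigma$ satisfies $\sigma'\ge\mathrm{Lan}_\iota\sigma$ (it exists under the stated assumptions on $G$). $\mathrm{Lan}_{\iota_A}\sigma_A:HA\to GA$ is the left Kan extension of order-preserving maps, $\mathrm{Lan}_{\iota_A}\sigma_A(x)=\bigvee\{\sigma_A(y)\mid y\in FA,\ \iota_A(y)\le x\}$. A poset is $\kappa$-directed if every subset of cardinality $<\kappa$ has an upper bound. *)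

(* Defs.v *)
From HB Require Import structures.
From mathcomp Require Import all_boot all_order.
From mathcomp Require Import boolp classical_sets functions cardinality.

Set Implicit Arguments.
Unset Strict Implicit.
Unset Printing Implicit Defensive.

Import Order.TTheory.
Local Open Scope order_scope.
Local Open Scope classical_set_scope.
Local Open Scope card_scope.

(* A cardinal is represented by a type of that cardinality. *)
Definition card_below (K T : Type) (S : set T) : Prop :=
  (S #<= [set: K]) /\ ~ ([set: K] #<= S).

(* Fewer than K sets can always be indexed by some J : set K, and their union
   embedded in K, so it is enough to quantify over families of subsets of K. *)
Definition regular_cardinal (K : Type) : Prop :=
  infinite_set [set: K] /\
  forall (J : set K) (X : K -> set K),
    card_below K J -> (forall j, J j -> card_below K (X j)) ->
    card_below K (\bigcup_(j in J) X j).

Section Posets.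
Context {d : Order.disp_t}.

(* The subset D, with the induced order, is a K-directed poset: the upper
   bounds are required to lie in D. *)
Definition kdirected (K : Type) (T : porderType d) (D : set T) : Prop :=
  forall S : set T, S `<=` D -> card_below K S -> D `&` ubound S !=set0.

Definition complete (T : porderType d) : Prop :=
  (forall S : set T, supremums S !=set0) /\
  (forall S : set T, infimums S !=set0).

Definition join (T : porderType d) (cT : complete T) (S : set T) : T :=
  sval (cid (cT.1 S)).

Definition preserves_join (T U : porderType d) (f : T -> U) (S : set T) : Prop :=
  forall x, supremums S x -> supremums (f @` S) (f x).

Definition preserves_meet (T U : porderType d) (f : T -> U) (S : set T) : Prop :=
  forall x, infimums S x -> infimums (f @` S) (f x).

Definition left_adjoint (T U : porderType d)
    (l : {omorphism U -> T}) (r : {omorphism T -> U}) : Prop :=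
  forall u t, (l u <= t) = (u <= r t).

Definition lan (X Y T : porderType d) (cT : complete T)
    (i : {omorphism X -> Y}) (s : {omorphism X -> T}) (y : Y) : T :=
  join cT (s @` [set x | i x <= y]).

End Posets.

Record poCategory (d : Order.disp_t) := PoCategory {
  ob :> Type;
  hom : ob -> ob -> porderType d;
  idm : forall A, hom A A;
  comp : forall A B C, hom B C -> hom A B -> hom A C;
  comp_idl : forall A B (f : hom A B), comp (idm B) f = f;
  comp_idr : forall A B (f : hom A B), comp f (idm A) = f;
  comp_assoc : forall A B C D (h : hom C D) (g : hom B C) (f : hom A B),
    comp h (comp g f) = comp (comp h g) f;
  comp_mono : forall A B C (g g' : hom B C) (f f' : hom A B),
    g <= g' -> f <= f' -> comp g f <= comp g' f' }.

Arguments comp {d p A B C}.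
Arguments hom {d p}.
Arguments idm {d p}.

(* Enriched functors to Pos, where hom-posets are ordered pointwise. *)
Record posFunctor (d d' : Order.disp_t) (C : poCategory d) := PosFunctor {
  fob :> C -> porderType d';
  fmap : forall A B : C, hom A B -> {omorphism fob A -> fob B};
  fmap_id : forall (A : C) (x : fob A), fmap (idm A) x = x;
  fmap_comp : forall (A B D : C) (g : hom B D) (f : hom A B) (x : fob A),
    fmap (comp g f) x = fmap g (fmap f x);
  fmap_mono : forall (A B : C) (f g : hom A B),
    f <= g -> forall x : fob A, fmap f x <= fmap g x }.

Arguments posFunctor {d} d' C.
Arguments fmap {d d' C} p {A B}.

Record strict_transf (d d' : Order.disp_t) (C : poCategory d)
    (F G : posFunctor d' C) := StrictTransf {
  strict_app :> forall A : C, {omorphism F A -> G A};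
  strict_nat : forall (A B : C) (f : hom A B) (x : F A),
    fmap G f (strict_app A x) = strict_app B (fmap F f x) }.

Record colax_transf (d d' : Order.disp_t) (C : poCategory d)
    (Sigma : forall A B : C, set (hom A B)) (F G : posFunctor d' C) :=
  ColaxTransf {
  colax_app :> forall A : C, {omorphism F A -> G A};
  colax_nat : forall (A B : C) (f : hom A B) (x : F A),
    fmap G f (colax_app A x) <= colax_app B (fmap F f x);
  colax_sigma : forall (A B : C) (f : hom A B), Sigma A B f ->
    forall x : F A, fmap G f (colax_app A x) = colax_app B (fmap F f x) }.

Definition extends (d d' : Order.disp_t) (C : poCategory d)
    (Sigma : forall A B : C, set (hom A B)) (F G H : posFunctor d' C)
    (iota : strict_transf F H) (sigma : colax_transf Sigma F G)
    (tau : colax_transf Sigma H G) : Prop :=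
  forall (A : C) (y : F A), sigma A y <= tau A (iota A y).

Definition is_left_extension (d d' : Order.disp_t) (C : poCategory d)
    (Sigma : forall A B : C, set (hom A B)) (F G H : posFunctor d' C)
    (iota : strict_transf F H) (sigma : colax_transf Sigma F G)
    (lam : colax_transf Sigma H G) : Prop :=
  extends iota sigma lam /\
  forall tau : colax_transf Sigma H G, extends iota sigma tau ->
    forall (A : C) (x : H A), lam A x <= tau A x.

(* Main.v *)
(* Objectwise left Kan extension is always the least candidate, so everything
   reduces to checking that the family [lan (iota A) (sigma A)] is itself a
   [Sigma]-natural colax transformation.  By (G1) and (iota1), [Gf] commutes with
   the joins defining it, which gives colaxity.  For [f] in [Sigma], if
   [iota_B y <= Hf x] then by (iota2) the transposed element [Ff_* y] satisfies
   [iota_A (Ff_* y) <= x] and [sigma_B y <= Gf (sigma_A (Ff_* y))], which gives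
   the reverse inequality. *)

Require Import Defs.
From HB Require Import structures.
From mathcomp Require Import all_boot all_order.
From mathcomp Require Import boolp classical_sets functions cardinality.

Set Implicit Arguments.
Unset Strict Implicit.
Unset Printing Implicit Defensive.

Import Order.TTheory.
Local Open Scope order_scope.
Local Open Scope classical_set_scope.

Lemma card_below_le (K T U : Type) (S : set T) (S' : set U) :
  (S' #<= S)%card -> card_below K S -> card_below K S'.
Proof.
move=> leS [SK nKS]; split; first exact: card_le_trans leS SK.
by move=> KS'; apply: nKS; exact: card_le_trans KS' leS.
Qed.

(** Choosing one preimage in [D] for each element of [S] gives a set no larger than [S]; an upper
    bound of it in [D] is sent by [f] to an upper bound of [S]. *)
Lemma kdirected_image (d : Order.disp_t) (K : Type) (T U : porderType d)
    (f : {omorphism T -> U}) (D : set T) :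
  kdirected K D -> kdirected K (f @` D).
Proof.
move=> dirD S SfD cS.
(* Directedness applied to the empty set yields a point of [D], the default value of the choice
   function [g] outside [S]. *)
have [t0 [Dt0 _]] : D `&` ubound set0 !=set0.
  by apply: dirD => //; apply: card_below_le cS; exact: card_ge0.
have /choice[g gP] : forall u, exists t, D t /\ (S u -> f t = u).
  move=> u; have [/SfD[t Dt <-]|nSu] := pselect (S u); first by exists t.
  by exists t0.
have [|t [Dt ubt]] := dirD (g @` S) _ (card_below_le (card_image_le g S) cS).
  by move=> _ [u _ <-]; exact: (gP u).1.
exists (f t); split; first by exists t.
move=> u Su; rewrite -((gP u).2 Su); apply: omorph_le.
by apply: ubt; exists u.
Qed.

Section Lan.
Context {d : Order.disp_t}.

Lemma join_ub (T : porderType d) (cT : complete T) (S : set T) :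
  ubound S (join cT S).
Proof. by rewrite /join; case: cid => x []. Qed.

Lemma join_le (T : porderType d) (cT : complete T) (S : set T) (z : T) :
  ubound S z -> join cT S <= z.
Proof. by rewrite /join; case: cid => x [_ /= lex] /lex. Qed.

Lemma join_supremums (T : porderType d) (cT : complete T) (S : set T) :
  supremums S (join cT S).
Proof. by rewrite /join; case: cid. Qed.

Context (X Y T : porderType d) (cT : complete T).
Context (i : {omorphism X -> Y}) (s : {omorphism X -> T}).

Lemma lan_ub (x : X) (y : Y) : i x <= y -> s x <= lan cT i s y.
Proof. by move=> ixy; apply: join_ub; exists x. Qed.

Lemma lan_le (y : Y) (z : T) :
  (forall x, i x <= y -> s x <= z) -> lan cT i s y <= z.
Proof. by move=> sz; apply: join_le => _ [x ixy <-]; exact: sz. Qed.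

Lemma lan_homo : {homo lan cT i s : y y' / y <= y'}.
Proof.
by move=> y y' yy'; apply: lan_le => x ixy; apply: lan_ub; exact: le_trans yy'.
Qed.

(** The components of a [colax_transf] must be bundled order morphisms. *)
HB.instance Definition _ :=
  Order.isOrderMorphism.Build d Y d T (lan cT i s) lan_homo.

Lemma preserves_lan_le (U : porderType d) (g : {omorphism T -> U}) (y : Y) (z : U) :
  preserves_join g (s @` [set x | i x <= y]) ->
  (forall x, i x <= y -> g (s x) <= z) -> g (lan cT i s y) <= z.
Proof.
move=> /(_ _ (join_supremums cT _)) [_ /= least] gz.
by apply: least => _ [_ [x ixy <-] <-]; exact: gz.
Qed.

End Lan.

Theorem theorem5p2 (d d' : Order.disp_t) (C : poCategory d)
  (Sigma : forall A B : C, set (hom A B))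
  (F G H : posFunctor d' C)
  (G_complete : forall A : C, complete (G A))
  (G_sigma : forall (A B : C) (f : hom A B), Sigma A B f ->
     forall S : set (G A),
       preserves_meet (fmap G f) S /\ preserves_join (fmap G f) S)
  (iota : strict_transf F H)
  (kappa : Type) (kappa_regular : regular_cardinal kappa)
  (G1 : forall (A B : C) (f : hom A B) (D : set (G A)),
     kdirected kappa D -> preserves_join (fmap G f) D)
  (iota1 : forall (A : C) (x : H A),
     kdirected kappa [set y : F A | iota A y <= x])
  (iota2 : forall (A B : C) (f : hom A B), Sigma A B f ->
     exists (Ff : {omorphism F B -> F A}) (Hf : {omorphism H B -> H A}),
       [/\ left_adjoint Ff (fmap F f), left_adjoint Hf (fmap H f)
         & forall y : F B, iota A (Ff y) = Hf (iota B y)])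
  (sigma : colax_transf Sigma F G) :
  (exists lam : colax_transf Sigma H G, is_left_extension iota sigma lam) /\
  (forall lam : colax_transf Sigma H G, is_left_extension iota sigma lam ->
     forall (A : C) (x : H A),
       lam A x = lan (G_complete A) (iota A) (sigma A) x).
Proof.
have lan_colax (A B : C) (f : hom A B) (x : H A) :
    fmap G f (lan (G_complete A) (iota A) (sigma A) x) <=
    lan (G_complete B) (iota B) (sigma B) (fmap H f x).
  apply: preserves_lan_le.
    by apply: G1; apply: kdirected_image; exact: iota1.
  move=> y iyx; apply: le_trans (colax_nat _ _ _) _; apply: lan_ub.
  (* Strictness of [iota] reduces the bound to [iota A y <= x], by monotonicity of [fmap H f]. *)
  by rewrite -strict_nat; exact: omorph_le.
have lan_sigma (A B : C) (f : hom A B) : Sigma A B f -> forall x : H A,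
    fmap G f (lan (G_complete A) (iota A) (sigma A) x) =
    lan (G_complete B) (iota B) (sigma B) (fmap H f x).
  move=> Sf x; apply/le_anti; rewrite lan_colax /=.
  (* Here [Ff] and [Hf] are the left adjoints of [fmap F f] and [fmap H f]; [FFfy] below is the unit
     of the first adjunction. *)
  have [Ff [Hf [adjF adjH iotaFf]]] := iota2 _ _ _ Sf.
  apply: lan_le => y iyHx.
  have FFfy : y <= fmap F f (Ff y) by rewrite -adjF.
  apply: (le_trans (omorph_le (sigma B) FFfy)).
  rewrite -colax_sigma //; apply: omorph_le; apply: lan_ub.
  (* The remaining [iota A (Ff y) <= x] is the transpose of [iyHx]. *)
  by rewrite iotaFf adjH.
pose L := @ColaxTransf _ _ _ Sigma H G
  (fun A => lan (G_complete A) (iota A) (sigma A)) lan_colax lan_sigma.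
have L_extends : extends iota sigma L by move=> A y; exact: lan_ub.
have L_least (tau : colax_transf Sigma H G) : extends iota sigma tau ->
    forall (A : C) (x : H A), L A x <= tau A x.
  move=> ext A x; apply: lan_le => y iyx.
  by apply: le_trans (ext A y) _; exact: omorph_le.
split; first by exists L.
(* Both [lam] and [L] are least among the extensions, so each lies below the other. *)
move=> lam [lam_ext lam_least] A x; apply/le_anti.
by rewrite (lam_least L) // (L_least lam).
Qed.
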